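(* Let $D$ be a condensed domain and let $a$ be an atom in $D$. Then: (1) if $b,c$ are co-maximal non-units of $D$ (that is, $bD+cD=D$), then $a$ is co-maximal with $b$ or with $c$ (that is, $aD+bD=D$ or $aD+cD=D$); (2) $a$ belongs to a unique maximal ideal of $D$.
   Context: Let $D$ be an integral domain. For nonzero ideals $I,J$ of $D$, the product ideal $IJ$ is called condensed if $IJ=\{ij : i\in I,\ j\in J\}$. $D$ is a condensed domain if $IJ$ is condensed for every pair of nonzero ideals $I,J$ of $D$. An element $a\in D$ is an atom (irreducible) if $a$ is a nonzero non-unit such that $a=xy$ with $x,y\in D$ implies $x$ is a unit or $y$ is a unit. *)

(* Defs.v *)
From HB Require Import structures.
From mathcomp Require Import all_boot all_order all_algebra.
From mathcomp Require Import all_classical.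

Set Implicit Arguments.
Unset Strict Implicit.
Unset Printing Implicit Defensive.

Import GRing.Theory.

Local Open Scope classical_set_scope.
Local Open Scope ring_scope.

(* MathComp's idealr_closed is not used: it forces ideals to be proper,
   whereas the unit ideal is an ideal here. *)
Definition is_ideal (D : idomainType) (I : set D) : Prop :=
  [/\ I 0,
      forall x y, I x -> I y -> I (x + y)
    & forall r x, I x -> I (r * x)].

Definition ideal_mul (D : idomainType) (I J : set D) : set D :=
  [set x | exists (n : nat) (u v : 'I_n -> D),
     [/\ forall k, I (u k), forall k, J (v k)
       & x = \sum_(k < n) u k * v k]].

Definition ideal_add (D : idomainType) (I J : set D) : set D :=
  [set x + y | x in I & y in J].

Definition principal (D : idomainType) (a : D) : set D :=
  [set a * x | x in [set: D]].

Definition condensed_product (D : idomainType) (I J : set D) : Prop :=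
  ideal_mul I J = [set i * j | i in I & j in J].

Definition condensed_domain (D : idomainType) : Prop :=
  forall I J : set D, is_ideal I -> is_ideal J ->
    I <> [set 0] -> J <> [set 0] -> condensed_product I J.

Definition atom (D : idomainType) (a : D) : Prop :=
  [/\ a != 0, a \isn't a GRing.unit
    & forall x y : D, a = x * y ->
        x \is a GRing.unit \/ y \is a GRing.unit].

Definition comaximal (D : idomainType) (a b : D) : Prop :=
  ideal_add (principal a) (principal b) = [set: D].

Definition maximal_ideal (D : idomainType) (M : set D) : Prop :=
  [/\ is_ideal M, M <> [set: D]
    & forall J : set D, is_ideal J -> M `<=` J -> J = M \/ J = [set: D]].

(* Main.v *)
Require Import Defs.
From mathcomp Require Import all_boot all_order all_algebra.
From mathcomp Require Import all_classical.

Local Open Scope ring_scope.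

(** If [b] and [c] are co-maximal, then [a] lies in the product of the ideals
    [(a, b)] and [(a, c)], because [a] times a Bezout relation is a combination
    of [a * c] and [b * a].  Condensedness factors [a] as an element of [(a, b)]
    times an element of [(a, c)]; one factor is a unit, so one of the two ideals
    is [D].  Two distinct maximal ideals containing [a] would contain co-maximal
    [b] and [c] respectively, contradicting this. *)

Import GRing.Theory.
Local Open Scope classical_set_scope.

Section Ideals.
Set Implicit Arguments.
Unset Strict Implicit.

Variable D : idomainType.
Implicit Types (a b c x y : D) (I J M N : set D).

Lemma principal_ideal a : is_ideal (principal a).
Proof.
split.
- by exists 0 => //; rewrite mulr0.
- by move=> _ _ [x _ <-] [y _ <-]; exists (x + y) => //; rewrite mulrDr.
- by move=> r _ [x _ <-]; exists (r * x) => //; rewrite mulrCA.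
Qed.

Lemma principal_id a : principal a a.
Proof. by exists 1 => //; rewrite mulr1. Qed.

Lemma ideal_add_ideal I J :
  is_ideal I -> is_ideal J -> is_ideal (ideal_add I J).
Proof.
move=> [I0 ID IM] [J0 JD JM]; split.
- by exists 0 => //; exists 0 => //; rewrite addr0.
- move=> _ _ [x Ix [y Jy <-]] [x' Ix' [y' Jy' <-]].
  exists (x + x'); first exact: ID.
  by exists (y + y'); [exact: JD | rewrite addrACA].
- move=> r _ [x Ix [y Jy <-]]; exists (r * x); first exact: IM.
  by exists (r * y); [exact: JM | rewrite mulrDr].
Qed.

Lemma ideal_add_subl I J : is_ideal J -> I `<=` ideal_add I J.
Proof. by move=> [J0 _ _] x Ix; exists x => //; exists 0 => //; rewrite addr0. Qed.

Lemma ideal_add_subr I J : is_ideal I -> J `<=` ideal_add I J.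
Proof. by move=> [I0 _ _] x Jx; exists 0 => //; exists x => //; rewrite add0r. Qed.

Lemma ideal_add_sub I J M :
  is_ideal M -> I `<=` M -> J `<=` M -> ideal_add I J `<=` M.
Proof. by move=> [_ MD _] IM JM _ [x /IM Mx [y /JM My <-]]; exact: MD. Qed.

Lemma principal_sub a I : is_ideal I -> I a -> principal a `<=` I.
Proof. by move=> [_ _ IM] Ia _ [x _ <-]; rewrite mulrC; exact: IM. Qed.

Lemma ideal_unit_setT I x :
  is_ideal I -> I x -> x \is a GRing.unit -> I = [set: D].
Proof.
move=> [_ _ IM] Ix Ux; apply/seteqP; split=> // y _.
by rewrite -(mulrVK Ux y); exact: IM.
Qed.

Lemma ideal_neqT I : is_ideal I -> I <> [set: D] <-> ~ I 1.
Proof.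
move=> Iid; split=> [IT I1|I1 IT]; last by apply: I1; rewrite IT.
by apply: IT; apply: (ideal_unit_setT Iid I1); exact: unitr1.
Qed.

Lemma principal_proper a :
  a \isn't a GRing.unit -> principal a <> [set: D].
Proof.
move=> Ua; apply/(ideal_neqT (principal_ideal a)) => -[x _ ax1].
by move/negP: Ua; apply; apply/unitrPr; exists x.
Qed.

(** Totality of the chain serves closure under addition: of the two members holding [x] and [y], the
    larger holds both. Nonemptiness supplies 0. *)
Lemma bigcup_chain_ideal (F : set (set D)) :
  F !=set0 -> total_on F subset -> F `<=` @is_ideal D ->
  is_ideal (\bigcup_(X in F) X).
Proof.
move=> [X FX] Ftot Fid; split.
- by exists X => //; have [] := Fid _ FX.
- move=> x y [Y FY Yx] [Z FZ Zy].
  have [YZ|ZY] := Ftot _ _ FY FZ.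
    by exists Z => //; have [_ + _] := Fid _ FZ; apply=> //; exact: YZ.
  by exists Y => //; have [_ + _] := Fid _ FY; apply=> //; exact: ZY.
- by move=> r x [Y FY Yx]; exists Y => //; have [_ _] := Fid _ FY; apply.
Qed.

Lemma maximal_ideal_exists I : is_ideal I -> I <> [set: D] ->
  exists2 M, maximal_ideal M & I `<=` M.
Proof.
move=> Iid IT.
(* Zorn_bigcup also asks for the union of the empty chain, hence the [I `|` _]. *)
pose P : set (set D) := [set X | is_ideal (I `|` X) /\ ~ (I `|` X) 1].
have I1 : ~ I 1 by apply/(ideal_neqT Iid).
have [F FP Ftot|A [[Aid A1] Amax]] := @Zorn_bigcup D P.
  have [->|F0] := eqVneq F set0.
    by rewrite bigcup_set0; split; rewrite setU0.
  (* As [F] is nonempty, adjoining [I] to the union amounts to adjoining it to each member. The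
     result is the union of a chain of ideals that all avoid 1. *)
  have FE : I `|` \bigcup_(X in F) X
      = \bigcup_(Y in [set I `|` X | X in F]) Y.
    rewrite bigcup_image; move/set0P: F0 => [X FX].
    apply/seteqP; split=> x.
      by move=> [Ix|[Y FY Yx]]; [exists X => //; left | exists Y => //; right].
    by move=> [Y FY [Ix|Yx]]; [left | right; exists Y].
  split; last first.
    by rewrite FE bigcup_image => -[X /FP[_]].
  rewrite FE; apply: bigcup_chain_ideal.
  - by move/set0P: F0 => [X FX]; exists (I `|` X); exists X.
  - move=> _ _ [X FX <-] [Y FY <-].
    by have [XY|YX] := Ftot _ _ FX FY; [left | right]; apply: setUS.
  - by move=> _ [X /FP[Xid _] <-].
exists (I `|` A); last exact: subsetUl.
split=> //; first exact/ideal_neqT.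
move=> J Jid AJ; have [JT|JT] := pselect (J = [set: D]); [by right | left].
(* A proper ideal [J] above [I] absorbs [I], so [J] itself satisfies [P]; as it contains [A],
   maximality of [A] leaves no room for [J] to be larger. *)
have IJ : I `|` J = J by apply/setUidPr => x Ix; apply: AJ; left.
have JA : J `<=` A.
  apply: contrapT => nJA; apply: (Amax J).
    by split=> // x Ax; apply: AJ; right.
  by split; rewrite IJ //; apply/ideal_neqT.
by apply/seteqP; split=> // x /JA; right.
Qed.

Lemma maximal_ideal_neq_comaximal M N :
  maximal_ideal M -> maximal_ideal N -> M <> N ->
  exists b c, [/\ M b, N c & comaximal b c].
Proof.
move=> [Mid MT Mmax] [Nid NT Nmax] MN.
have Sid := ideal_add_ideal Mid Nid.
(* Otherwise maximality of [M] gives [M + N = M], so [N] lies in [M], and maximality of [N] then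
   forces [M = N] or [M = D]. The summands of 1 in [M + N] are the required [b] and [c]. *)
have ST : ideal_add M N = [set: D].
  have [SM|//] := Mmax _ Sid (@ideal_add_subl M N Nid).
  have NM : N `<=` M by rewrite -[X in _ `<=` X]SM; exact: ideal_add_subr.
  by have [/MN|/MT] := Nmax _ Mid NM.
have [b Mb [c Nc bc1]] : ideal_add M N 1 by rewrite ST.
exists b, c; split=> //.
have [bid cid] := (principal_ideal b, principal_ideal c).
apply: (ideal_unit_setT (ideal_add_ideal bid cid) _ (unitr1 D)).
exists b; first exact: principal_id.
by exists c => //; exact: principal_id.
Qed.

Lemma condensed_atom_comaximal a b c : condensed_domain D -> atom a ->
  comaximal b c -> comaximal a b \/ comaximal a c.
Proof.
move=> hD [a0 _ airr] bc.
have pid := principal_ideal.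
have addid x y := ideal_add_ideal (pid x) (pid y).
have mema x : ideal_add (principal a) (principal x) a.
  by apply: ideal_add_subl => //; exact: principal_id.
have memr x : ideal_add (principal a) (principal x) x.
  by apply: ideal_add_subr => //; exact: principal_id.
have nz x : ideal_add (principal a) (principal x) <> [set 0].
  by move=> E; have := mema x; rewrite E /= => /eqP; rewrite (negbTE a0).
have [_ [r _ <-] [_ [s _ <-] brcs1]] :
  ideal_add (principal b) (principal c) 1 by rewrite bc.
have : ideal_mul (ideal_add (principal a) (principal b))
                 (ideal_add (principal a) (principal c)) a.
  (* The two terms are [b * (r * a)] and [a * (s * c)], with sum [a * (b * r + c * s) = a]. The left
     factors are generators of [(a, b)]; the right ones are multiples of generators of [(a, c)]. *)
  exists 2, (fun k => if k == ord0 then b else a),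
    (fun k => if k == ord0 then r * a else s * c); split.
  - by move=> k; case: ifP.
  - by move=> k; have [_ _ M] := addid a c; case: ifP => _; apply: M.
  - rewrite !big_ord_recl big_ord0 /= addr0 mulrA [b * r * a]mulrC -mulrDr.
    by rewrite [s * c]mulrC brcs1 mulr1.
rewrite (hD _ _ (addid a b) (addid a c) (nz b) (nz c)) => -[i abi [j acj ija]].
have [Ui|Uj] := airr _ _ (esym ija).
  by left; exact: ideal_unit_setT (addid a b) abi Ui.
by right; exact: ideal_unit_setT (addid a c) acj Uj.
Qed.

Lemma maximal_ideal_not_comaximal M a b :
  maximal_ideal M -> M a -> M b -> ~ comaximal a b.
Proof.
move=> [Mid MT _] Ma Mb ab; apply: MT; apply/seteqP; split=> //.
by rewrite -ab; apply: ideal_add_sub => //; exact: principal_sub.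
Qed.

End Ideals.

Theorem lemmaA (D : idomainType) (hD : condensed_domain D)
    (a : D) (ha : atom a) :
  (forall b c : D, b \isn't a GRing.unit -> c \isn't a GRing.unit ->
     comaximal b c -> comaximal a b \/ comaximal a c)
  /\ (exists! M : set D, maximal_ideal M /\ M a).
Proof.
split=> [b c _ _|]; first exact: condensed_atom_comaximal.
have [_ Ua _] := ha.
have [M Mmax aM] :=
  maximal_ideal_exists (principal_ideal a) (principal_proper Ua).
have Ma : M a by apply: aM; exact: principal_id.
exists M; split=> // N [Nmax Na]; apply: contrapT => MN.
have [b [c [Mb Nc bc]]] := maximal_ideal_neq_comaximal Mmax Nmax MN.
(* Both [a] and [b] lie in [M], and both [a] and [c] lie in [N], so either alternative would make a
   maximal ideal equal to [D]. *)
have [ab|ac] := condensed_atom_comaximal hD ha bc.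
  exact: (maximal_ideal_not_comaximal Mmax Ma Mb ab).
exact: (maximal_ideal_not_comaximal Nmax Na Nc ac).
Qed.
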